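(* Let $n\ge 2$ and let $\mu_1,\dots,\mu_n$ be complex numbers, none of which is a non-negative integer. Let the ground field be $\mathbb{C}(q,q^{\mu_1},\dots,q^{\mu_n})$. Then the extended Jones--Wenzl projector $P_{\mu_1,\dots,\mu_n}\in \mathrm{End}_{U_q(\mathfrak{sl}_2)}(M(\mu_1)\otimes\cdots\otimes M(\mu_n))$ (defined recursively in the context) satisfies $$P_{\mu_1,\dots,\mu_n}^2=P_{\mu_1,\dots,\mu_n}.$$
   Context: Conventions on $q$: $q$ is generic. The symbols $q^z$ ($z\in\mathbb{C}$) are formal powers of $q$, i.e. elements of a field containing $\mathbb{C}(q)$ with $q^0=1$, $q^1=q$, $q^{a+b}=q^aq^b$, and $q^z=1$ only for $z=0$. The field $\mathbb{C}(q,q^{\mu_1},\dots,q^{\mu_n})$ is generated over $\mathbb{C}$ by the indicated elements; all algebras, modules, tensor products and linear maps are over this ground field. For a complex number $z$ put $[z]:=\frac{q^z-q^{-z}}{q-q^{-1}}$. For integers $0\le l\le k$ put $[k]!:=[k][k-1]\cdots[1]$ (with $[0]!:=1$) and $\begin{bmatrix}k\\ l\end{bmatrix}:=\frac{[k]!}{[l]!\,[k-l]!}$. Empty products equal $1$. $U_q(\mathfrak{sl}_2)$ is the associative unital algebra over the ground field generated by $K,K^{-1},E,F$ with relations $KK^{-1}=1=K^{-1}K$, $KE=q^2EK$, $KF=q^{-2}FK$, $EF-FE=\frac{K-K^{-1}}{q-q^{-1}}$, and coproduct $\Delta(K^{\pm1})=K^{\pm1}\otimes K^{\pm1}$, $\Delta(F)=F\otimes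 1+K^{-1}\otimes F$, $\Delta(E)=E\otimes K+1\otimes E$. Tensor products of modules are modules via $\Delta$. For a complex number $\mu$ that is not a non-negative integer, the Verma module $M(\mu)$ has basis $v_0,v_1,v_2,\dots$ and action $Kv_i=q^{\mu-2i}v_i$, $Ev_i=[i]v_{i-1}$, $Fv_i=[\mu-i]v_{i+1}$, where $v_{-1}=0$. Write $v_{i,j}:=v_i\otimes v_j\in M(\mu)\otimes M(\lambda)$. Define linear maps $E_{\mu,\lambda}:M(\mu)\otimes M(\lambda)\to M(\mu+\lambda)$ and $F_{\mu,\lambda}:M(\mu+\lambda)\to M(\mu)\otimes M(\lambda)$ by $$E_{\mu,\lambda}(v_{i,j}):=q^{i(\lambda-j)}v_{i+j},\qquad F_{\mu,\lambda}(v_k):=\sum_{j=0}^k q^{-(k-j)(\mu-j)}\begin{bmatrix}k\\ j\end{bmatrix}\frac{\prod_{i=0}^{j-1}[\mu-i]\,\prod_{i=0}^{k-j-1}[\lambda-i]}{\prod_{i=0}^{k-1}[\mu+\lambda-i]}\,v_{j,k-j}.$$ Put $E_{\mu,\lambda;\nu_1,\dots,\nu_i}:=E_{\mu,\lambda}\otimes\mathrm{Id}_{M(\nu_1)}\otimes\cdots\otimes\mathrm{Id}_{M(\nu_i)}$ and $F_{\mu,\lambda;\nu_1,\dots,\nu_i}:=F_{\mu,\lambda}\otimes\mathrm{Id}_{M(\nu_1)}\otimes\cdots\otimes\mathrm{Id}_{M(\nu_i)}$. The extended Jones--Wenzl projectors are defined recursively by $$P_{\mu_1,\mu_2}:=F_{\mu_1,\mu_2}E_{\mu_1,\mu_2},$$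 and, for $n>2$, $$P_{\mu_1,\dots,\mu_n}:=F_{\mu_1,\mu_2;\mu_3,\dots,\mu_n}\,P_{\mu_1+\mu_2,\mu_3,\dots,\mu_n}\,E_{\mu_1,\mu_2;\mu_3,\dots,\mu_n},$$ products denoting composition of maps.
   Formalization: That the projector is U_q(sl_2)-linear is proved when no partial sum μ_1+…+μ_r (2≤r≤n) is a non-negative integer; otherwise F has zero denominators and P is undefined (e.g. μ_1=μ_2=1/2). P²=P is proved without this condition, with 1/0 read as 0. *)

(* Defs.v *)
From HB Require Import structures.
From mathcomp Require Import all_boot all_order all_algebra.
From mathcomp Require Import finmap.
From mathcomp Require Import complex.
From mathcomp Require Import boolp reals.
From mathcomp Require Import monalg.

Set Implicit Arguments.
Unset Strict Implicit.
Unset Printing Implicit Defensive.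

Import Order.TTheory GRing.Theory Num.Theory.
Local Open Scope ring_scope.

(* Formal powers of a generic q in a field L containing C(q), where q is
   [qpow 1] and C is [R[i]] for a model R of the real numbers.  Genericity
   of q is its transcendence over C. *)
Record formal_powers (R : realType) (L : fieldType) := FormalPowers {
  qemb : {rmorphism R[i] -> L};
  qpow : R[i] -> L;
  qpow_generic : forall p : {poly R[i]}, root (map_poly qemb p) (qpow 1) -> p = 0;
  qpow0 : qpow 0 = 1;
  qpowD : forall a b : R[i], qpow (a + b) = qpow a * qpow b;
  qpow_eq1 : forall z : R[i], qpow z = 1 -> z = 0
}.

Section GroundField.
Variables (R : realType) (L : fieldType) (Q : formal_powers R L).
Variable mu : seq R[i].

(* Membership in the smallest subfield of L containing C, q and the q^mu_i. *)
Definition in_ground : {pred L} := fun x =>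
  `[< forall S : {pred L}, divring_closed S ->
      (forall c : R[i], qemb Q c \in S) ->
      qpow Q 1 \in S ->
      (forall m, m \in mu -> qpow Q m \in S) ->
      x \in S >].

Lemma in_ground_divring_closed : divring_closed in_ground.
Proof.
split=> [|x y /asboolP xS /asboolP yS|x y /asboolP xS /asboolP yS];
  apply/asboolP => S S_divring Sc Sq Smu.
- by case: S_divring.
- by case: (S_divring) => _ + _; apply; [exact: xS|exact: yS].
- by case: (S_divring) => _ _ +; apply; [exact: xS|exact: yS].
Qed.

HB.instance Definition _ :=
  GRing.isDivringClosed.Build L in_ground in_ground_divring_closed.

(* The field C(q, q^mu_1, ..., q^mu_n). *)
Record ground_field := GroundField {
  ground_val : L;
  ground_valP : ground_val \in in_ground
}.

HB.instance Definition _ := [isSub for ground_val].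
HB.instance Definition _ := [Choice of ground_field by <:].
HB.instance Definition _ :=
  [SubChoice_isSubComUnitRing of ground_field by <:].
HB.instance Definition _ :=
  [SubComUnitRing_isSubIntegralDomain of ground_field by <:].
HB.instance Definition _ :=
  [SubIntegralDomain_isSubField of ground_field by <:].

(* q^z as an element of the ground field; the value 0 is used when q^z lies
   outside of it, which never happens for z in Z + Z mu_1 + ... + Z mu_n. *)
Definition gpow (z : R[i]) : ground_field := insubd 0 (qpow Q z).

Lemma gpowE z : qpow Q z \in in_ground -> ground_val (gpow z) = qpow Q z.
Proof. by move=> zS; rewrite -[LHS]/(val (gpow z)) insubdK. Qed.

Lemma in_ground_pow1 : qpow Q 1 \in in_ground.
Proof. by apply/asboolP=> S _ _ + _; apply. Qed.

Lemma in_ground_pow m : m \in mu -> qpow Q m \in in_ground.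
Proof. by move=> mmu; apply/asboolP=> S _ _ _; apply. Qed.

Lemma in_ground_powB a b : qpow Q a \in in_ground -> qpow Q b \in in_ground ->
  qpow Q (a - b) \in in_ground.
Proof.
move=> aS bS; have -> : qpow Q (a - b) = qpow Q a / qpow Q b.
  have /(congr1 (fun x => qpow Q (a - b) * x)) : qpow Q b * qpow Q (- b) = 1.
    by rewrite -qpowD subrr qpow0.
  move=> h; have b0 : qpow Q b != 0.
    apply: contraTneq (oner_neq0 L) => b0.
    by rewrite -(qpow0 Q) -(subrr b) qpowD b0 mul0r eqxx.
  by apply: (mulIf b0); rewrite divfK// -qpowD subrK.
exact: rpred_div.
Qed.

End GroundField.

(* The vector space with basis indexed by a choiceType I is [{malg K[I]}], the
   finitely supported functions I -> K, with basis vectors [<< i >>]. *)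
Section LinearExtension.
Variables (K : fieldType) (I J : choiceType).

Definition lin_ext (phi : I -> {malg K[J]}) (x : {malg K[I]}) : {malg K[J]} :=
  \sum_(i <- msupp x) x@_i *: phi i.

Lemma lin_ext_widen (phi : I -> {malg K[J]}) (x : {malg K[I]}) (D : {fset I}) :
  (msupp x `<=` D)%fset -> lin_ext phi x = \sum_(i <- D) x@_i *: phi i.
Proof.
move=> xD; rewrite /lin_ext (big_fset_incl _ xD)// => i _ ix.
by rewrite mcoeff_outdom// scale0r.
Qed.

Lemma lin_ext_is_linear (phi : I -> {malg K[J]}) : linear (lin_ext phi).
Proof.
move=> a x y.
pose D := (msupp (a *: x + y) `|` (msupp x `|` msupp y))%fset.
rewrite (@lin_ext_widen _ _ D) ?fsubsetUl//.
rewrite (@lin_ext_widen _ x D); last first.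
  by rewrite /D fsetUCA fsubsetUl.
rewrite (@lin_ext_widen _ y D); last first.
  by rewrite /D fsetUA fsubsetUr.
rewrite scaler_sumr -big_split/=; apply: eq_bigr => i _.
by rewrite mcoeffD mcoeffZ scalerDl scalerA.
Qed.

HB.instance Definition _ (phi : I -> {malg K[J]}) :=
  GRing.isLinear.Build K {malg K[I]} {malg K[J]} *:%R (lin_ext phi)
    (lin_ext_is_linear phi).

End LinearExtension.

(* Tensor products of spaces with basis: [{malg K[I * J]}] is the tensor
   product of [{malg K[I]}] and [{malg K[J]}]. *)
Section Tensor.
Variable K : fieldType.

Definition tens_vec (I J : choiceType) (x : {malg K[I]}) (y : {malg K[J]}) :
    {malg K[(I * J)%type]} :=
  \sum_(i <- msupp x) \sum_(j <- msupp y) << x@_i * y@_j *g (i, j) >>.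

Definition tens_map (I I' J J' : choiceType)
    (f : {linear {malg K[I]} -> {malg K[I']}})
    (g : {linear {malg K[J]} -> {malg K[J']}}) :
    {linear {malg K[(I * J)%type]} -> {malg K[(I' * J')%type]}} :=
  lin_ext (fun ij : I * J => tens_vec (f << ij.1 >>) (g << ij.2 >>)).

End Tensor.

(* A U_q(sl_2)-module, given by the operators through which the generators act;
   [Uq_module] states the defining relations of U_q(sl_2). *)
Record Uq_action (K : fieldType) (I : choiceType) := UqAction {
  actK : {linear {malg K[I]} -> {malg K[I]}};
  actKV : {linear {malg K[I]} -> {malg K[I]}};
  actE : {linear {malg K[I]} -> {malg K[I]}};
  actF : {linear {malg K[I]} -> {malg K[I]}}
}.

Section ExtendedJonesWenzl.
Variables (R : realType) (K : fieldType) (qp : R[i] -> K).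
Local Notation C := R[i].
Local Notation q := (qp 1).

Definition qnum (z : C) : K := (qp z - qp (- z)) / (q - q^-1).

Definition qfact (k : nat) : K := \prod_(1 <= i < k.+1) qnum i%:R.

Definition qbinom (k l : nat) : K := qfact k / (qfact l * qfact (k - l)).

Definition Uq_module (I : choiceType) (V : Uq_action K I) : Prop :=
  [/\ forall v, actK V (actKV V v) = v /\ actKV V (actK V v) = v,
      forall v, actK V (actE V v) = q ^+ 2 *: actE V (actK V v),
      forall v, actK V (actF V v) = q ^- 2 *: actF V (actK V v) &
      forall v, actE V (actF V v) - actF V (actE V v) =
                (q - q^-1)^-1 *: (actK V v - actKV V v)].

Definition Uq_linear (I J : choiceType) (V : Uq_action K I) (W : Uq_action K J)
    (f : {linear {malg K[I]} -> {malg K[J]}}) : Prop :=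
  [/\ forall v, f (actK V v) = actK W (f v),
      forall v, f (actKV V v) = actKV W (f v),
      forall v, f (actE V v) = actE W (f v) &
      forall v, f (actF V v) = actF W (f v)].

(* The ground field with the action given by the counit. *)
Definition Uq_trivial : Uq_action K unit :=
  UqAction idfun idfun \0 \0.

(* The action on a tensor product through the coproduct. *)
Definition Uq_tens (I J : choiceType) (V : Uq_action K I) (W : Uq_action K J) :
    Uq_action K (I * J)%type :=
  UqAction (tens_map (actK V) (actK W))
           (tens_map (actKV V) (actKV W))
           (tens_map (actE V) (actK W) \+ tens_map idfun (actE W))
           (tens_map (actF V) idfun \+ tens_map (actKV V) (actF W)).

(* The Verma module M(m), with v_i = << i >>. *)
Definition verma (m : C) : Uq_action K nat :=
  UqAction
    (lin_ext (fun i : nat => << qp (m - 2 * i%:R) *g i >>))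
    (lin_ext (fun i : nat => << (qp (m - 2 * i%:R))^-1 *g i >>))
    (lin_ext (fun i : nat => if i is i'.+1 then << qnum i%:R *g i' >> else 0))
    (lin_ext (fun i : nat => << qnum (m - i%:R) *g i.+1 >>)).

Definition Emap (m l : C) :
    {linear {malg K[(nat * nat)%type]} -> {malg K[nat]}} :=
  lin_ext (fun ij : nat * nat =>
    << qp (ij.1%:R * (l - ij.2%:R)) *g (ij.1 + ij.2)%N >>).

(* The denominators vanish only if m + l is a non-negative integer, in which
   case M(m + l) is not defined; division by zero then yields 0. *)
Definition Fmap (m l : C) :
    {linear {malg K[nat]} -> {malg K[(nat * nat)%type]}} :=
  lin_ext (fun k : nat => \sum_(j < k.+1)
    << qp (- ((k - j)%:R * (m - j%:R))) * qbinom k j *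
       ((\prod_(i < j) qnum (m - i%:R)) *
        (\prod_(i < k - j) qnum (l - i%:R)) /
        \prod_(i < k) qnum (m + l - i%:R))
       *g (val j, (k - j)%N) >>).

(* For V with basis I, the tensor product (V (x) M(nu_1)) (x) ... (x) M(nu_r)
   has basis [tidx I nu] and action [Uq_tens_vermas V nu]; [tmap f nu] is
   f (x) Id (x) ... (x) Id. *)
Fixpoint tidx (I : choiceType) (nu : seq C) : choiceType :=
  if nu is _ :: nu' then tidx (I * nat)%type nu' else I.

Fixpoint Uq_tens_vermas (I : choiceType) (V : Uq_action K I) (nu : seq C) :
    Uq_action K (tidx I nu) :=
  match nu with
  | [::] => V
  | n :: nu' => Uq_tens_vermas (Uq_tens V (verma n)) nu'
  end.

Fixpoint tmap (I J : choiceType) (f : {linear {malg K[I]} -> {malg K[J]}})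
    (nu : seq C) : {linear {malg K[tidx I nu]} -> {malg K[tidx J nu]}} :=
  match nu with
  | [::] => f
  | _ :: nu' => tmap (tens_map f idfun) nu'
  end.

(* P_(m, l, nu_1, ..., nu_r) *)
Fixpoint JW_rec (m l : C) (nu : seq C) :
    {linear {malg K[tidx (nat * nat)%type nu]} ->
            {malg K[tidx (nat * nat)%type nu]}} :=
  match nu with
  | [::] => Fmap m l \o Emap m l
  | n :: nu' =>
      tmap (Fmap m l) (n :: nu') \o
        (JW_rec (m + l) n nu' \o tmap (Emap m l) (n :: nu'))
  end.

(* The tensor product M(mu_1) (x) ... (x) M(mu_n), associated to the left. *)
Definition vidx (mu : seq C) : choiceType :=
  if mu is m :: nu then tidx nat nu else unit.

Definition verma_tensor (mu : seq C) : Uq_action K (vidx mu) :=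
  match mu with
  | [::] => Uq_trivial
  | m :: nu => Uq_tens_vermas (verma m) nu
  end.

(* P_(mu_1, ..., mu_n), relevant for n >= 2 only. *)
Definition JW (mu : seq C) :
    {linear {malg K[vidx mu]} -> {malg K[vidx mu]}} :=
  match mu with
  | m :: l :: nu => JW_rec m l nu
  | _ => idfun
  end.

End ExtendedJonesWenzl.

(* Main.v *)
From HB Require Import structures.
Require Import Defs.
From mathcomp Require Import all_boot all_order all_algebra.
From mathcomp Require Import complex.
From mathcomp Require Import reals.
From mathcomp Require Import boolp finmap monalg.
From mathcomp Require Import ring.

Set Implicit Arguments.
Unset Strict Implicit.
Unset Printing Implicit Defensive.

Import Order.TTheory GRing.Theory Num.Theory.
Local Open Scope ring_scope.

(** Write e : M(m) (x) M(l) -> M(m + l) and f : M(m + l) -> M(m) (x) M(l) for the two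
    structure maps ([Emap] and [Fmap]), and T_k(z) for [z][z - 1]...[z - k + 1].
    If m + l is not a non-negative integer, then e f is the identity, and an
    induction on n gives P^2 = f P' e f P' e = f P' P' e = f P' e = P, where P' is
    the projector with one factor less.  Both e and f are U_q(sl_2)-linear, hence
    so is P.

    Everything about f comes from one observation: up to the scalar 1 / T_k(m + l),
    the vector f(v_k) is w_k = Delta(F)^k (v_0 (x) v_0), a member of the string
    generated by the highest weight vector of M(m) (x) M(l) ([hw_stringS], which is
    the q-Pascal identity).  As e is linear and sends v_0 (x) v_0 to v_0, it
    sends w_k to F^k v_0 = T_k(m + l) v_k ([Emap_hw_string]); this replaces a
    q-Vandermonde summation.  The action of E on w_k follows from the relation
    between E and F ([hw_stringE]), and this yields the linearity of f.

    When m + l = N is a non-negative integer, T_k(N) = 0 for k > N, and with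
    1 / 0 = 0 the map f kills v_k for k > N; so e f is the projection [trunc N] onto
    the span of v_0, ..., v_N instead of the identity.  Idempotence survives:
    f(v_k) only involves those v_j (x) v_(k - j) with T_j(m) <> 0, so [trunc m] (x) Id
    fixes the image of f ([trunc_Fmap]), hence the image of every projector
    whose first weight is m ([trunc_JW_rec]).  In P^2 = f P' (e f) P' e the middle
    projection is thus absorbed by the factor P' to its right.  With
    T_k(z) / T_k(z), which is 1 or 0, as the coefficients of [trunc z], the
    generic and the degenerate cases become one.

    The powers q^z belong to the ground field only for some z, among them the
    integral combinations of 1, mu_1, ..., mu_n; the computations are
    carried out for a function z |-> q^z that is exponential on a subgroup G
    of the exponents. *)

(** * Linear maps between spaces with a basis *)

Arguments tens_map : simpl never.
Arguments Emap : simpl never.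
Arguments Fmap : simpl never.

Section FreeSpaces.
Variable K : fieldType.
Implicit Types I J : choiceType.

Lemma malgUZ I (c : K) (i : I) : << c *g i >> = c *: << i >> :> {malg K[I]}.
Proof. by apply/malgP => k; rewrite mcoeffZ !mcoeffU mulr_natr. Qed.

Lemma malg_basisE I (x : {malg K[I]}) : x = \sum_(i <- msupp x) x@_i *: << i >>.
Proof. by rewrite {1}[x]monalgE; apply: eq_bigr => i _; exact: malgUZ. Qed.

Lemma lin_extU I J (phi : I -> {malg K[J]}) i : lin_ext phi << i >> = phi i.
Proof.
by rewrite /lin_ext msuppU oner_eq0 big_seq_fset1 mcoeffUU scale1r.
Qed.

Lemma tens_vecE I J (x : {malg K[I]}) (y : {malg K[J]}) :
  tens_vec x y = lin_ext (fun i => lin_ext (fun j => << (i, j) >>) y) x.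
Proof.
rewrite /tens_vec /lin_ext; apply: eq_bigr => i _.
rewrite scaler_sumr; apply: eq_bigr => j _.
by rewrite malgUZ scalerA.
Qed.

Lemma tens_vecDl I J (x x' : {malg K[I]}) (y : {malg K[J]}) :
  tens_vec (x + x') y = tens_vec x y + tens_vec x' y.
Proof. by rewrite !tens_vecE linearD. Qed.

Lemma tens_vecZl I J c (x : {malg K[I]}) (y : {malg K[J]}) :
  tens_vec (c *: x) y = c *: tens_vec x y.
Proof. by rewrite !tens_vecE linearZ. Qed.

(** Linearity of [tens_vec] in its second argument amounts to linearity of
    [lin_ext phi] in phi. *)
Lemma lin_ext_fun_linear I J c (phi psi : I -> {malg K[J]}) x :
  lin_ext (fun i => c *: phi i + psi i) x = c *: lin_ext phi x + lin_ext psi x.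
Proof.
rewrite /lin_ext scaler_sumr -big_split; apply: eq_bigr => i _ /=.
by rewrite scalerDr !scalerA mulrC.
Qed.

Lemma tens_vecPr I J c (x : {malg K[I]}) (y y' : {malg K[J]}) :
  tens_vec x (c *: y + y') = c *: tens_vec x y + tens_vec x y'.
Proof.
rewrite !tens_vecE -lin_ext_fun_linear.
by congr (lin_ext _ _); apply: funext => i; rewrite linearP.
Qed.

Lemma tens_vec0l I J (y : {malg K[J]}) : tens_vec (0 : {malg K[I]}) y = 0.
Proof. by rewrite tens_vecE linear0. Qed.

Lemma tens_vec0r I J (x : {malg K[I]}) : tens_vec x (0 : {malg K[J]}) = 0.
Proof.
by have:= tens_vecPr (-1) x 0 (0 : {malg K[J]}); rewrite scaler0 addr0 scaleN1r addNr.
Qed.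

Lemma tens_vecZr I J c (x : {malg K[I]}) (y : {malg K[J]}) :
  tens_vec x (c *: y) = c *: tens_vec x y.
Proof. by rewrite -[c *: y]addr0 tens_vecPr tens_vec0r addr0. Qed.

Lemma tens_vecDr I J (x : {malg K[I]}) (y y' : {malg K[J]}) :
  tens_vec x (y + y') = tens_vec x y + tens_vec x y'.
Proof. by rewrite -[y]scale1r tens_vecPr !scale1r. Qed.

Lemma tens_vecBl I J (x x' : {malg K[I]}) (y : {malg K[J]}) :
  tens_vec (x - x') y = tens_vec x y - tens_vec x' y.
Proof. by rewrite tens_vecDl -scaleN1r tens_vecZl scaleN1r. Qed.

Lemma tens_vecBr I J (x : {malg K[I]}) (y y' : {malg K[J]}) :
  tens_vec x (y - y') = tens_vec x y - tens_vec x y'.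
Proof. by rewrite tens_vecDr -scaleN1r tens_vecZr scaleN1r. Qed.

Lemma tens_vecU I J (i : I) (j : J) :
  tens_vec << i >> << j >> = << (i, j) >> :> {malg K[(I * J)%type]}.
Proof. by rewrite tens_vecE !lin_extU. Qed.

Lemma malg_ind I (P : {malg K[I]} -> Prop) :
  P 0 -> (forall c i x, P x -> P (c *: << i >> + x)) -> forall x, P x.
Proof.
move=> P0 PD x; rewrite (malg_basisE x).
by elim/big_rec: _ => // i y _; exact: PD.
Qed.

Lemma tens_mapU I I' J J' (f : {linear {malg K[I]} -> {malg K[I']}})
    (g : {linear {malg K[J]} -> {malg K[J']}}) i j :
  tens_map f g << (i, j) >> = tens_vec (f << i >>) (g << j >>).
Proof. exact: lin_extU. Qed.

Lemma tens_mapE I I' J J' (f : {linear {malg K[I]} -> {malg K[I']}})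
    (g : {linear {malg K[J]} -> {malg K[J']}}) x y :
  tens_map f g (tens_vec x y) = tens_vec (f x) (g y).
Proof.
elim/malg_ind: x => [|c i x IHx]; first by rewrite tens_vec0l !linear0 tens_vec0l.
rewrite tens_vecDl tens_vecZl linearP IHx linearP tens_vecDl tens_vecZl.
suff -> : tens_map f g (tens_vec << i >> y) = tens_vec (f << i >>) (g y) by [].
elim/malg_ind: y {IHx} => [|d j y IHy]; first by rewrite tens_vec0r !linear0 tens_vec0r.
by rewrite tens_vecPr linearP IHy linearP tens_vecPr tens_vecU tens_mapU.
Qed.

(** The types are spelled out so that the scaling of a vector is not itself
    taken for an instance of f. *)
Lemma malg_linearZ I J (f : {linear {malg K[I]} -> {malg K[J]}}) c x :
  f (c *: x) = c *: f x.
Proof. exact: linearZ. Qed.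

Lemma malg_lincomb I J (f : {linear {malg K[I]} -> {malg K[J]}}) a b x y :
  f (a *: x + b *: y) = a *: f x + b *: f y.
Proof. by rewrite linearD !malg_linearZ. Qed.

Lemma linear_eq_on_basis I L (f g : {malg K[I]} -> {malg K[L]}) :
  linear f -> linear g -> (forall i, f << i >> = g << i >>) -> f =1 g.
Proof.
move=> f_lin g_lin fg; elim/malg_ind => [|c i z IHz].
  have lin0 (h : {malg K[I]} -> {malg K[L]}) : linear h -> h 0 = 0.
    by move=> /(_ (-1) 0 0); rewrite scaler0 addr0 scaleN1r addNr.
  by rewrite !lin0.
by rewrite f_lin g_lin IHz fg.
Qed.

Lemma linear_eq_on_tens I J L (f g : {malg K[(I * J)%type]} -> {malg K[L]}) :
  linear f -> linear g ->
  (forall x y, f (tens_vec x y) = g (tens_vec x y)) -> f =1 g.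
Proof.
move=> f_lin g_lin fg; apply: linear_eq_on_basis => // -[i j].
by rewrite -tens_vecU.
Qed.

Lemma tens_map_idfun_comp I I' I'' J
    (f' : {linear {malg K[I']} -> {malg K[I'']}})
    (f : {linear {malg K[I]} -> {malg K[I']}})
    (g : {linear {malg K[I]} -> {malg K[I'']}}) :
  (forall x, f' (f x) = g x) ->
  forall z, tens_map f' idfun (tens_map f idfun z) =
    tens_map g (idfun : {malg K[J]} -> _) z.
Proof.
move=> f'fg; apply: linear_eq_on_tens => [a u v|a u v|x y]; rewrite ?linearP //.
by rewrite !tens_mapE f'fg.
Qed.

Lemma scale_lincomb2 (V : lmodType K) a b c d (v w : V) :
  a *: (b *: (c *: v + d *: w)) = (a * (b * c)) *: v + (a * (b * d)) *: w.
Proof. by rewrite !scalerDr !scalerA !mulrA. Qed.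

Lemma scale_lincomb (V : lmodType K) a b c d (v : V) :
  a *: (b *: v) + c *: (d *: v) = (a * b + c * d) *: v.
Proof. by rewrite !scalerA scalerDl. Qed.

End FreeSpaces.

(** * Representations and their tensor products *)

Section TMap.
Variables (R : realType) (K : fieldType).
Implicit Types (nu : seq R[i]).

Lemma tmap_comp (I I' I'' : choiceType) nu
    (f' : {linear {malg K[I']} -> {malg K[I'']}})
    (f : {linear {malg K[I]} -> {malg K[I']}})
    (g : {linear {malg K[I]} -> {malg K[I'']}}) :
  (forall x, f' (f x) = g x) -> forall x, tmap f' nu (tmap f nu x) = tmap g nu x.
Proof.
elim: nu I I' I'' f' f g => [//|n nu IHnu] I I' I'' f' f g f'fg /=.
by apply: IHnu; exact: tens_map_idfun_comp.
Qed.

End TMap.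

Section UqModules.
Variables (R : realType) (K : fieldType) (qp : R[i] -> K).
Local Notation q := (qp 1).

Section Tensor.
Variables (I J : choiceType) (V : Uq_action K I) (W : Uq_action K J).

Lemma Uq_tensK x y :
  actK (Uq_tens V W) (tens_vec x y) = tens_vec (actK V x) (actK W y).
Proof. exact: tens_mapE. Qed.

Lemma Uq_tensKV x y :
  actKV (Uq_tens V W) (tens_vec x y) = tens_vec (actKV V x) (actKV W y).
Proof. exact: tens_mapE. Qed.

Lemma Uq_tensE x y : actE (Uq_tens V W) (tens_vec x y) =
  tens_vec (actE V x) (actK W y) + tens_vec x (actE W y).
Proof. by congr (_ + _); exact: tens_mapE. Qed.

Lemma Uq_tensF x y : actF (Uq_tens V W) (tens_vec x y) =
  tens_vec (actF V x) y + tens_vec (actKV V x) (actF W y).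
Proof. by congr (_ + _); exact: tens_mapE. Qed.

Definition Uq_tens_act := (Uq_tensK, Uq_tensKV, Uq_tensE, Uq_tensF).

(** In the commutator of E and F on x (x) y, the mixed terms
    E K^-1 x (x) K F y and K^-1 E x (x) F K y cancel: moving E past K^-1 costs q^2
    and moving K past F costs q^-2. What remains telescopes to K (x) K - K^-1 (x) K^-1. *)
Lemma Uq_tens_module : q != 0 ->
  Uq_module qp V -> Uq_module qp W -> Uq_module qp (Uq_tens V W).
Proof.
move=> q_neq0 [VK VKE VKF VEF] [WK WKE WKF WEF].
have EKV v : actE V (actKV V v) = q ^+ 2 *: actKV V (actE V v).
  by rewrite -[LHS](VK _).2 VKE (VK v).1 linearZ.
move: Uq_tens_act; move: (Uq_tens V W) => T tens_act.
split.
- suff: (forall v, actK T (actKV T v) = v) /\ (forall v, actKV T (actK T v) = v).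
    by move=> [KKV KVK] v.
  split; apply: linear_eq_on_tens => [a u v|a u v|x y]; rewrite ?linearP //.
    by rewrite !tens_act (VK _).1 (WK _).1.
  by rewrite !tens_act (VK _).2 (WK _).2.
- apply: linear_eq_on_tens => [a u v|a u v|x y].
  + by rewrite !linearP.
  + by rewrite !linearP.
  rewrite !tens_act linearD !tens_act VKE WKE.
  by rewrite tens_vecZl tens_vecZr scalerDr.
- apply: linear_eq_on_tens => [a u v|a u v|x y].
  + by rewrite !linearP.
  + by rewrite !linearP.
  rewrite !tens_act linearD !tens_act VKF WKF (VK _).1 (VK _).2.
  by rewrite tens_vecZl tens_vecZr scalerDr.
- apply: linear_eq_on_tens => [a u v|a u v|x y].
  + by rewrite !linearP addrACA scalerDr.
  + by rewrite !linearP addrACA -!scalerDr linearP.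
  rewrite !tens_act !(linearD (actE T), linearD (actF T)) !tens_act EKV WKF.
  rewrite tens_vecZl tens_vecZr scalerA divff ?expf_neq0 // scale1r.
  rewrite [X in _ - X]addrACA opprD addrACA !opprD.
  rewrite [X in X + _]addrACA [X in _ + X]addrACA !subrr addr0 add0r.
  rewrite -tens_vecBl -tens_vecBr VEF WEF tens_vecZl tens_vecZr -scalerDr.
  by rewrite tens_vecBl tens_vecBr addrA subrK.
Qed.

End Tensor.

Lemma Uq_module_EF (I : choiceType) (V : Uq_action K I) v : Uq_module qp V ->
  actE V (actF V v) =
  actF V (actE V v) + (q - q^-1)^-1 *: (actK V v - actKV V v).
Proof. by move=> [_ _ _ /(_ v) <-]; rewrite addrC subrK. Qed.

(** Commuting with K forces commuting with its inverse. *)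
Lemma Uq_linear_KEF (I J : choiceType) (V : Uq_action K I) (W : Uq_action K J)
    (f : {linear {malg K[I]} -> {malg K[J]}}) :
  Uq_module qp V -> Uq_module qp W ->
  (forall v, f (actK V v) = actK W (f v)) ->
  (forall v, f (actE V v) = actE W (f v)) ->
  (forall v, f (actF V v) = actF W (f v)) -> Uq_linear V W f.
Proof.
move=> [VK _ _ _] [WK _ _ _] fK fE fF; split=> // v.
by rewrite -[LHS](WK _).2 -fK (VK v).1.
Qed.

Lemma Uq_linear_comp I J L (U : Uq_action K I) (V : Uq_action K J)
    (W : Uq_action K L) (g : {linear {malg K[J]} -> {malg K[L]}})
    (f : {linear {malg K[I]} -> {malg K[J]}}) :
  Uq_linear V W g -> Uq_linear U V f -> Uq_linear U W (g \o f).
Proof.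
move=> [gK gKV gE gF] [fK fKV fE fF].
by split=> v /=; rewrite ?fK ?fKV ?fE ?fF ?gK ?gKV ?gE ?gF.
Qed.

Lemma Uq_linear_tens I J L (U : Uq_action K I) (V : Uq_action K J)
    (W : Uq_action K L) (f : {linear {malg K[I]} -> {malg K[J]}}) :
  Uq_linear U V f -> Uq_linear (Uq_tens U W) (Uq_tens V W) (tens_map f idfun).
Proof.
move=> [fK fKV fE fF].
move: (Uq_tens_act U W) (Uq_tens_act V W).
move: (Uq_tens U W) (Uq_tens V W) => S T S_act T_act.
split; apply: linear_eq_on_tens => [a u v|a u v|x y]; rewrite ?linearP //.
- by rewrite S_act !tens_mapE T_act fK.
- by rewrite S_act !tens_mapE T_act fKV.
- by rewrite S_act linearD !tens_mapE T_act fE.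
- by rewrite S_act linearD !tens_mapE T_act fF fKV.
Qed.

Lemma Uq_linear_tmap I J (U : Uq_action K I) (V : Uq_action K J)
    (f : {linear {malg K[I]} -> {malg K[J]}}) (nu : seq R[i]) :
  Uq_linear U V f ->
  Uq_linear (Uq_tens_vermas qp U nu) (Uq_tens_vermas qp V nu) (tmap f nu).
Proof.
elim: nu I J U V f => [//|n nu IHnu] I J U V f f_lin /=.
by apply: IHnu; exact: Uq_linear_tens.
Qed.

End UqModules.

(** * Quantum integers *)

Section FormalPowers.
Variables (R : realType) (K : fieldType) (qp : R[i] -> K).
Variable G : zmodClosed R[i].
Local Notation q := (qp 1).
Local Notation "[ z ]q" := (qnum qp z) (format "[ z ]q").
Hypothesis G1 : 1 \in G.
Hypothesis qp0 : qp 0 = 1.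
Hypothesis qpD : {in G &, {morph qp : a b / a + b >-> a * b}}.
Hypothesis qp_eq1 : {in G, forall z, qp z = 1 -> z = 0}.

Lemma G_nat k : k%:R \in G. Proof. exact: rpredMn. Qed.

Lemma qp_neq0 z : z \in G -> qp z != 0.
Proof.
move=> zG; apply/eqP => z0; have := oner_neq0 K.
by rewrite -qp0 -(subrr z) qpD ?rpredN // z0 mul0r eqxx.
Qed.

Lemma qpN z : z \in G -> qp (- z) = (qp z)^-1.
Proof.
move=> zG; apply: (mulfI (qp_neq0 zG)).
by rewrite -qpD ?rpredN // subrr qp0 divff ?qp_neq0.
Qed.

Lemma qpB : {in G &, forall a b, qp (a - b) = qp a / qp b}.
Proof. by move=> a b aG bG; rewrite qpD ?rpredN // qpN. Qed.

Lemma qpMn k z : z \in G -> qp (k%:R * z) = qp z ^+ k.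
Proof.
move=> zG; elim: k => [|k IHk]; first by rewrite mul0r qp0.
by rewrite -natr1 mulrDl mul1r qpD ?IHk ?exprSr // mulr_natl rpredMn.
Qed.

Lemma qp_nat k : qp k%:R = q ^+ k.
Proof. by rewrite -[k%:R]mulr1 qpMn. Qed.

Lemma q_neq0 : q != 0. Proof. exact: qp_neq0. Qed.

(** q^z = q^-z gives q^(2 z) = 1, hence 2 z = 0. *)
Lemma qpow_sub_inv_neq0 z : z \in G -> z != 0 -> qp z - (qp z)^-1 != 0.
Proof.
move=> zG; apply: contraNneq => /(canRL (subrK _)); rewrite add0r => qpz.
have /eqP : 2%:R * z = 0.
  apply: qp_eq1; first by rewrite mulr_natl rpredMn.
  by rewrite qpMn // expr2 {1}qpz mulVf ?qp_neq0.
by rewrite mulf_eq0 pnatr_eq0.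
Qed.

Lemma qden_neq0 : q - q^-1 != 0.
Proof. by rewrite qpow_sub_inv_neq0 ?oner_neq0. Qed.

Lemma qsqrB1_neq0 : q * q - 1 != 0.
Proof.
apply: contraNneq qden_neq0 => /(canRL (subrK _)); rewrite add0r => qq.
by apply/eqP; rewrite -[X in _ - X]mul1r -qq mulfK ?subrr ?q_neq0.
Qed.

Lemma qnumE z : z \in G -> [z]q = (qp z - (qp z)^-1) / (q - q^-1).
Proof. by move=> zG; rewrite /qnum qpN. Qed.

Lemma qnum_neq0 z : z \in G -> z != 0 -> [z]q != 0.
Proof.
move=> zG z0; rewrite qnumE // mulf_neq0 ?invr_eq0 ?qden_neq0 //.
exact: qpow_sub_inv_neq0.
Qed.

Lemma qnum0 : [0]q = 0.
Proof. by rewrite /qnum oppr0 subrr mul0r. Qed.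

Lemma qnumD a b : a \in G -> b \in G ->
  [a + b]q = qp b * [a]q + (qp a)^-1 * [b]q.
Proof.
move=> aG bG; rewrite !qnumE ?rpredD // qpD //.
by field; rewrite !qp_neq0 // qsqrB1_neq0.
Qed.

Lemma G_subn z k : z \in G -> z - k%:R \in G.
Proof. by move=> zG; rewrite rpredB ?G_nat. Qed.

Lemma qpBn z k : z \in G -> qp (z - k%:R) = qp z / q ^+ k.
Proof. by move=> zG; rewrite qpB ?G_nat // qp_nat. Qed.

Lemma qpB2n z k : z \in G -> qp (z - 2 * k%:R) = qp z / q ^+ k / q ^+ k.
Proof.
move=> zG; have -> : z - 2 * k%:R = z - k%:R - k%:R :> R[i] by ring.
by rewrite !qpBn ?G_subn.
Qed.

(** The scalar identity behind [E, F] = (K - K^-1) / (q - q^-1), on the vector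
    of weight z - 2 k in a highest weight module of weight z. *)
Lemma qnum_commutator z k : z \in G ->
  [z - k%:R]q * [k.+1%:R]q - [k%:R]q * [z - k%:R + 1]q =
  (q - q^-1)^-1 * (qp (z - 2 * k%:R) - (qp (z - 2 * k%:R))^-1).
Proof.
move=> zG; have zkG := G_subn k zG; have zk1G := rpredD zkG G1.
rewrite !qnumE ?G_nat //.
rewrite qpB2n // qpBn // qpD ?G_subn // qpBn // !qp_nat exprS.
by field; rewrite qsqrB1_neq0 q_neq0 expf_neq0 ?q_neq0 // qp_neq0.
Qed.

(** * Verma modules *)

Section VermaAction.
Variables (m : R[i]) (mG : m \in G).

Lemma vermaK k : actK (verma qp m) << k >> = qp (m - 2 * k%:R) *: << k >>.
Proof. by rewrite [LHS]lin_extU malgUZ. Qed.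

Lemma vermaKV k : actKV (verma qp m) << k >> = (qp (m - 2 * k%:R))^-1 *: << k >>.
Proof. by rewrite [LHS]lin_extU malgUZ. Qed.

(** For k = 0 the right-hand side is [0] v_0 = 0, in accordance with v_(-1) = 0. *)
Lemma vermaE k : actE (verma qp m) << k >> = [k%:R]q *: << k.-1 >>.
Proof.
rewrite [LHS]lin_extU; case: k => [|k]; first by rewrite qnum0 scale0r.
by rewrite malgUZ.
Qed.

Lemma vermaF k : actF (verma qp m) << k >> = [m - k%:R]q *: << k.+1 >>.
Proof. by rewrite [LHS]lin_extU malgUZ. Qed.

Definition verma_act := (vermaK, vermaKV, vermaE, vermaF).

Lemma verma_module : Uq_module qp (verma qp m).
Proof.
have Gm k : m - 2 * k%:R \in G by rewrite -natrM G_subn.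
have qm0 k : qp (m - 2 * k%:R) != 0 by rewrite qp_neq0.
move: verma_act; move: (verma qp m) => V V_act.
pose actZ := (malg_linearZ (actK V), malg_linearZ (actKV V),
             malg_linearZ (actE V), malg_linearZ (actF V)).
split.
- suff: (forall v, actK V (actKV V v) = v) /\ (forall v, actKV V (actK V v) = v).
    by move=> [KKV KVK] v.
  split; apply: linear_eq_on_basis => [a u v|a u v|k]; rewrite ?linearP //.
    by rewrite !(V_act, actZ) scalerA mulVf ?scale1r.
  by rewrite !(V_act, actZ) scalerA mulfV ?scale1r.
- apply: linear_eq_on_basis => [a u v|a u v|k].
  + by rewrite !linearP.
  + by rewrite !linearP.
  rewrite !(V_act, actZ) !scalerA.
  case: k => [|k]; first by rewrite qnum0 mul0r mulr0 scale0r.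
  congr (_ *: _); rewrite /= !qpB2n // [q ^+ k.+1]exprS.
  by field; rewrite q_neq0 expf_neq0 ?q_neq0.
- apply: linear_eq_on_basis => [a u v|a u v|k].
  + by rewrite !linearP.
  + by rewrite !linearP.
  rewrite !(V_act, actZ) !scalerA.
  congr (_ *: _); rewrite /= !qpB2n // [q ^+ k.+1]exprS.
  by field; rewrite q_neq0 expf_neq0 ?q_neq0.
- apply: linear_eq_on_basis => [a u v|a u v|k].
  + by rewrite !linearP addrACA scalerDr.
  + by rewrite !linearP addrACA -!scalerDr linearP.
  rewrite !(V_act, actZ) !scalerA -!scalerBl scalerA -qnum_commutator //.
  case: k => [|k] /=; first by rewrite qnum0 !mul0r scale0r !subr0.
  rewrite -scalerBl; congr ((_ - _ * [_]q) *: _).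
  by rewrite -natr1 opprD addrA subrK.
Qed.

End VermaAction.

(** * The intertwiners between M(m) (x) M(l) and M(m + l) *)

Definition qfall z k : K := \prod_(i < k) [z - i%:R]q.

Lemma qfallS z k : qfall z k.+1 = qfall z k * [z - k%:R]q.
Proof. exact: big_ord_recr. Qed.

Lemma qfall_neq0 z k : z \in G -> (forall i : nat, z <> i%:R) -> qfall z k != 0.
Proof.
move=> zG zN; rewrite prodf_seq_neq0; apply/allP => i _ /=.
by rewrite qnum_neq0 ?G_subn // subr_eq0; apply/eqP.
Qed.

Lemma qfactS k : qfact qp k.+1 = qfact qp k * [k.+1%:R]q.
Proof. by rewrite /qfact big_nat_recr. Qed.

Lemma qfact_neq0 k : qfact qp k != 0.
Proof.
rewrite prodf_seq_neq0; apply/allP => i; rewrite mem_index_iota => /andP[i0 _] /=.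
by rewrite qnum_neq0 ?G_nat // pnatr_eq0 -lt0n.
Qed.

Section Intertwiners.
Variables (m l : R[i]) (mG : m \in G) (lG : l \in G).
Local Notation ML := (Uq_tens (verma qp m) (verma qp l)).

(** The coefficient of v_j (x) v_d in Delta(F)^(j + d) (v_0 (x) v_0). Indexing by j and
    d rather than by j and k = j + d keeps truncated subtraction out of the
    recurrences. *)
Definition hw_coef j d : K :=
  (qp (m - j%:R) ^+ d)^-1 * (qfact qp (j + d) / (qfact qp j * qfact qp d)) *
  (qfall m j * qfall l d).

(** Delta(F)^k (v_0 (x) v_0), by [hw_string0] and [hw_stringS]. *)
Definition hw_string k : {malg K[(nat * nat)%type]} :=
  \sum_(j < k.+1) hw_coef j (k - j) *: tens_vec << val j >> << (k - j)%N >>.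

Lemma FmapU k : Fmap qp m l << k >> = (qfall (m + l) k)^-1 *: hw_string k.
Proof.
rewrite [LHS]lin_extU scaler_sumr; apply: eq_bigr => -[j /= jk] _.
rewrite malgUZ tens_vecU scalerA; congr (_ *: _).
rewrite /hw_coef qpN ?mulr_natl ?rpredMn ?G_subn // -mulr_natl qpMn ?G_subn //.
rewrite subnKC // /qbinom -/(qfall m j) -/(qfall l _) -/(qfall (m + l) k).
by rewrite mulrA mulrC.
Qed.

Lemma EmapU i j : Emap qp m l (tens_vec << i >> << j >>) =
  qp (l - j%:R) ^+ i *: << (i + j)%N >>.
Proof. by rewrite tens_vecU [LHS]lin_extU malgUZ qpMn ?G_subn. Qed.

Lemma hw_string0 : hw_string 0 = tens_vec << 0%N >> << 0%N >>.
Proof.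
rewrite /hw_string big_ord_recl big_ord0 addr0 /hw_coef /qfall !big_ord0 /=.
by rewrite /qfact big_nil !(expr0, mulr1, invr1) scale1r.
Qed.

Lemma tens_verma_module : Uq_module qp ML.
Proof. exact: (Uq_tens_module q_neq0 (verma_module mG) (verma_module lG)). Qed.

(** The two ways of reaching v_j (x) v_d by one application of Delta(F), each
    matched with one summand of [j + d] = q^-d [j] + q^j [d]. *)
Lemma hw_coefSl j d :
  [j.+1%:R]q / q ^+ d * hw_coef j.+1 d =
  [(j + d).+1%:R]q * (hw_coef j d * [m - j%:R]q).
Proof.
have jd : [j.+1%:R]q != 0 by rewrite qnum_neq0 ?G_nat // pnatr_eq0.
have -> : hw_coef j.+1 d = (qp (m - j%:R) ^+ d)^-1 * q ^+ d *
    (qfact qp (j + d).+1 / (qfact qp j.+1 * qfact qp d)) *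
    (qfall m j.+1 * qfall l d).
  rewrite /hw_coef addSn -[in qp _]natr1 opprD addrA.
  by rewrite (@qpBn _ 1%N) ?G_subn // expr1 expr_div_n invf_div [q ^+ d / _]mulrC.
rewrite /hw_coef !qfactS qfallS.
by field; rewrite jd !qfact_neq0 !expf_neq0 ?q_neq0 ?qp_neq0 ?G_subn.
Qed.

Lemma hw_coefSr j d :
  q ^+ j * [d.+1%:R]q * hw_coef j d.+1 =
  [(j + d).+1%:R]q * (hw_coef j d * ((qp (m - 2 * j%:R))^-1 * [l - d%:R]q)).
Proof.
have jd : [d.+1%:R]q != 0 by rewrite qnum_neq0 ?G_nat // pnatr_eq0.
rewrite /hw_coef addnS !qfactS qfallS exprS qpB2n // !qpBn //.
by field; rewrite jd !qfact_neq0 !expf_neq0 ?mulf_neq0 ?invr_eq0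
  ?expf_neq0 ?q_neq0 ?qp_neq0.
Qed.

Lemma tens_vermaF j d : actF ML (tens_vec << j >> << d >>) =
  [m - j%:R]q *: tens_vec << j.+1 >> << d >> +
  ((qp (m - 2 * j%:R))^-1 * [l - d%:R]q) *: tens_vec << j >> << d.+1 >>.
Proof.
by rewrite Uq_tensF vermaF vermaKV vermaF !tens_vecZl tens_vecZr scalerA.
Qed.

(** The q-Pascal identity. Both sides are multiplied by [k + 1] in order to
    avoid q-binomial coefficients outside of their range: after splitting
    [k + 1] = q^-d [j] + q^j [d] on the right-hand side, the terms that have no
    counterpart on the left carry the factor [0]. *)
Lemma hw_stringS k : actF ML (hw_string k) = hw_string k.+1.
Proof.
have k0 : [k.+1%:R]q != 0 by rewrite qnum_neq0 ?G_nat // pnatr_eq0.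
(* Only the action of F on elementary tensors of basis vectors matters. *)
move: tens_vermaF; move: (Uq_tens _ _) => T T_F.
apply: (scalerI k0); rewrite /hw_string linear_sum !scaler_sumr.
have split_coef (j : 'I_k.+2) : [k.+1%:R]q = [j%:R]q / q ^+ (k.+1 - j) +
    q ^+ j * [(k.+1 - j)%:R]q.
  rewrite -{1}(subnKC (ltnSE (ltn_ord j))) natrD addrC qnumD ?G_nat // !qp_nat.
  by rewrite addrC [X in _ = X + _]mulrC.
transitivity (\sum_(j < k.+2)
    (([j%:R]q / q ^+ (k.+1 - j) * hw_coef j (k.+1 - j)) *:
      tens_vec << val j >> << (k.+1 - j)%N >> +
     (q ^+ j * [(k.+1 - j)%:R]q * hw_coef j (k.+1 - j)) *:
      tens_vec << val j >> << (k.+1 - j)%N >>) : {malg K[(nat * nat)%type]}); last first.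
  by apply: eq_bigr => j _; rewrite scalerA (split_coef j) mulrDl scalerDl.
rewrite big_split [X in _ = X + _]big_ord_recl [X in _ = _ + X]big_ord_recr /=.
rewrite subnn !qnum0 mulr0 !mul0r !scale0r.
rewrite [X in _ = X + _]add0r [X in _ = _ + X]addr0 -big_split.
apply: eq_bigr => -[j jk] _ /=; rewrite /bump add1n subSS subSn //.
rewrite (malg_linearZ (actF T)) T_F scale_lincomb2.
have -> := hw_coefSl j (k - j); have -> := hw_coefSr j (k - j).
by rewrite (subnKC (jk : (j <= k)%N)).
Qed.

Lemma Emap_F x : Emap qp m l (actF ML x) = actF (verma qp (m + l)) (Emap qp m l x).
Proof.
move: EmapU; move: (Emap qp m l) => E E_U.
move: tens_vermaF; move: (Uq_tens _ _) => T T_F.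
move: (vermaF (m + l)); move: (verma qp (m + l)) => V V_F.
move: x; apply: linear_eq_on_basis => [a u v|a u v|[i j]]; rewrite ?linearP //.
rewrite -tens_vecU E_U T_F.
rewrite (malg_lincomb E) (malg_linearZ (actF V)) V_F.
rewrite (E_U i.+1) (E_U i j.+1).
rewrite addSn addnS scale_lincomb [RHS]scalerA; congr (_ *: _).
have -> : m + l - (i + j)%:R = (m - i%:R) + (l - j%:R).
  by rewrite natrD opprD addrACA.
have -> : l - j.+1%:R = l - j%:R - 1%:R by rewrite -natr1 opprD addrA.
rewrite (qnumD (G_subn i mG) (G_subn j lG)) (@qpBn _ 1%N) ?G_subn //.
rewrite expr1 expr_div_n (qpB2n i mG) (qpBn i mG) exprS.
by field; rewrite !expf_neq0 ?q_neq0 ?qp_neq0 ?G_subn.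
Qed.

Lemma tens_vermaK j d : actK ML (tens_vec << j >> << d >>) =
  qp (m + l - 2 * (j + d)%:R) *: tens_vec << j >> << d >>.
Proof.
rewrite Uq_tensK !vermaK tens_vecZl tens_vecZr scalerA; congr (_ *: _).
rewrite -qpD; first by congr (qp _); ring.
- by rewrite -natrM G_subn.
- by rewrite -natrM G_subn.
Qed.

Lemma tens_vermaE j d : actE ML (tens_vec << j >> << d >>) =
  ([j%:R]q * qp (l - 2 * d%:R)) *: tens_vec << j.-1 >> << d >> +
  [d%:R]q *: tens_vec << j >> << d.-1 >>.
Proof.
by rewrite Uq_tensE vermaE vermaK vermaE tens_vecZl !tens_vecZr scalerA.
Qed.

Lemma Emap_K x : Emap qp m l (actK ML x) = actK (verma qp (m + l)) (Emap qp m l x).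
Proof.
move: EmapU; move: (Emap qp m l) => E E_U.
move: tens_vermaK; move: (Uq_tens _ _) => T T_K.
move: (vermaK (m + l)); move: (verma qp (m + l)) => V V_K.
move: x; apply: linear_eq_on_basis => [a u v|a u v|[i j]]; rewrite ?linearP //.
rewrite -tens_vecU E_U T_K (malg_linearZ E) (malg_linearZ (actK V)) E_U V_K.
by rewrite !scalerA mulrC.
Qed.

Lemma Emap_E x : Emap qp m l (actE ML x) = actE (verma qp (m + l)) (Emap qp m l x).
Proof.
move: EmapU; move: (Emap qp m l) => E E_U.
move: tens_vermaE; move: (Uq_tens _ _) => T T_E.
move: (vermaE (m + l)); move: (verma qp (m + l)) => V V_E.
move: x; apply: linear_eq_on_basis => [a u v|a u v|[i j]]; rewrite ?linearP //.
rewrite -tens_vecU E_U T_E.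
rewrite (malg_lincomb E) (malg_linearZ (actE V)) V_E.
rewrite (E_U i.-1) (E_U i j.-1) [RHS]scalerA !scalerA.
have -> : ([i%:R]q * qp (l - 2 * j%:R) * qp (l - j%:R) ^+ i.-1) *: << (i.-1 + j)%N >>
    = (qp (l - j%:R) ^+ i * ((q ^+ j)^-1 * [i%:R]q)) *: << (i + j).-1 >> :> {malg K[nat]}.
  case: i => [|i] /=; first by rewrite qnum0 !(mul0r, mulr0) !scale0r.
  congr (_ *: _); rewrite qpB2n // -qpBn // exprS; ring.
have -> : ([j%:R]q * qp (l - j.-1%:R) ^+ i) *: << (i + j.-1)%N >>
    = (qp (l - j%:R) ^+ i * (q ^+ i * [j%:R]q)) *: << (i + j).-1 >> :> {malg K[nat]}.
  case: j => [|j] /=; first by rewrite qnum0 !(mul0r, mulr0) !scale0r.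
  rewrite addnS; congr (_ *: _).
  have -> : l - j%:R = l - j.+1%:R + 1 by rewrite -natr1 opprD addrA subrK.
  rewrite (qpD (G_subn j.+1 lG) G1) exprMn; ring.
rewrite -scalerDl -mulrDr; congr ((_ * _) *: _).
by rewrite natrD addrC [in RHS]addrC (qnumD (G_nat j) (G_nat i)) !qp_nat.
Qed.

Lemma Emap_linear : Uq_linear ML (verma qp (m + l)) (Emap qp m l).
Proof.
apply: Uq_linear_KEF; [exact: tens_verma_module|exact: verma_module (rpredD mG lG)|..].
- exact: Emap_K.
- exact: Emap_E.
- exact: Emap_F.
Qed.

(** The q-Vandermonde identity, obtained without summation: a linear map carries
    the string generated by v_0 (x) v_0 to the one generated by v_0. *)
Lemma Emap_hw_string k :
  Emap qp m l (hw_string k) = qfall (m + l) k *: << k >>.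
Proof.
elim: k => [|k IHk].
  by rewrite hw_string0 EmapU expr0 /qfall big_ord0.
by rewrite -hw_stringS Emap_F IHk malg_linearZ vermaF scalerA -qfallS.
Qed.

Lemma hw_stringK k :
  actK ML (hw_string k) = qp (m + l - 2 * k%:R) *: hw_string k.
Proof.
rewrite /hw_string linear_sum scaler_sumr; apply: eq_bigr => -[j jk] _ /=.
by rewrite (malg_linearZ (actK ML)) tens_vermaK (subnKC (jk : (j <= k)%N)) !scalerA mulrC.
Qed.

Lemma hw_stringKV k :
  actKV ML (hw_string k) = (qp (m + l - 2 * k%:R))^-1 *: hw_string k.
Proof.
have z0 : qp (m + l - 2 * k%:R) != 0.
  by rewrite qp_neq0 // -natrM G_subn // rpredD.
have [MK _ _ _] := tens_verma_module; apply: (scalerI z0).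
rewrite -(malg_linearZ (actKV ML)) -hw_stringK (MK _).2.
by rewrite scalerA mulfV // scale1r.
Qed.

(** On the string generated by a highest weight vector of weight m + l, E acts by
    the same scalars as in a Verma module, since E F - F E is known on weight
    vectors. For k = 0 the right-hand side vanishes through [0]. *)
Lemma hw_stringE k : actE ML (hw_string k) =
  ([k%:R]q * [m + l - k%:R + 1]q) *: hw_string k.-1.
Proof.
have E0 : actE ML (hw_string 0) = 0.
  by rewrite hw_string0 tens_vermaE qnum0 mul0r !scale0r addr0.
have EF i := Uq_module_EF (hw_string i) tens_verma_module.
move: E0 hw_stringS hw_stringK hw_stringKV EF.
move: (Uq_tens _ _) hw_string => T w E0 wS wK wKV EF.
elim: k => [|k IHk]; first by rewrite E0 qnum0 mul0r scale0r.
have -> : m + l - k.+1%:R + 1 = m + l - k%:R.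
  by rewrite -natr1 opprD addrA subrK.
rewrite -{1}wS EF IHk (malg_linearZ (actF T)) wK wKV.
rewrite -[X in _ + _ *: X]scalerBl [X in _ + X]scalerA.
rewrite -qnum_commutator ?rpredD //.
have -> : ([k%:R]q * [m + l - k%:R + 1]q) *: actF T (w k.-1) =
    ([k%:R]q * [m + l - k%:R + 1]q) *: w k.
  by case: k {IHk} => [|k]; rewrite ?wS // qnum0 mul0r !scale0r.
by rewrite -scalerDl addrC subrK mulrC.
Qed.

(** As v_k goes to w_k / T_k(m + l), the actions of E and F match because
    T_(k + 1)(m + l) = T_k(m + l) [m + l - k] with a nonzero last factor. *)
Lemma Fmap_linear :
  (forall k : nat, m + l <> k%:R) ->
  Uq_linear (verma qp (m + l)) ML (Fmap qp m l).
Proof.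
move=> mlN; have mlG := rpredD mG lG.
have T0 k : qfall (m + l) k != 0 by exact: qfall_neq0.
apply: Uq_linear_KEF; [exact: verma_module|exact: tens_verma_module|..].
all: move: FmapU; move: (Fmap qp m l) => F F_U.
- move: hw_stringK; move: (Uq_tens _ _) => T T_K.
  move: (vermaK (m + l)); move: (verma qp (m + l)) => V V_K.
  apply: linear_eq_on_basis => [a u v|a u v|k]; rewrite ?linearP //.
  rewrite V_K F_U (malg_linearZ F) (malg_linearZ (actK T)) T_K F_U.
  by rewrite !scalerA mulrC.
- move: hw_stringE; move: (Uq_tens _ _) => T T_E.
  move: (vermaE (m + l)); move: (verma qp (m + l)) => V V_E.
  apply: linear_eq_on_basis => [a u v|a u v|k]; rewrite ?linearP //.
  rewrite V_E F_U (malg_linearZ F) (malg_linearZ (actE T)) T_E F_U.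
  rewrite !scalerA; congr (_ *: _).
  case: k => [|k]; first by rewrite qnum0 !mul0r mulr0.
  have -> : m + l - k.+1%:R + 1 = m + l - k%:R.
    by rewrite -natr1 opprD addrA subrK.
  have := T0 k.+1; rewrite /= qfallS mulf_eq0 => /norP[Tk mlk].
  by field; rewrite Tk mlk.
- move: hw_stringS; move: (Uq_tens _ _) => T T_F.
  move: (vermaF (m + l)); move: (verma qp (m + l)) => V V_F.
  apply: linear_eq_on_basis => [a u v|a u v|k]; rewrite ?linearP //.
  rewrite V_F F_U (malg_linearZ F) (malg_linearZ (actF T)) T_F F_U.
  rewrite !scalerA; congr (_ *: _).
  have := T0 k.+1; rewrite qfallS mulf_eq0 => /norP[Tk mlk].
  by field; rewrite Tk mlk.
Qed.

End Intertwiners.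

(** * Truncation and the idempotence of the projectors *)

(** The identity if z is not a non-negative integer; if z = N is one, the
    coefficients are 1 for k <= N and 0 / 0 = 0 for k > N. *)
Definition trunc z : {linear {malg K[nat]} -> {malg K[nat]}} :=
  lin_ext (fun k => (qfall z k / qfall z k) *: << k >>).

Lemma truncU z k : trunc z << k >> = (qfall z k / qfall z k) *: << k >>.
Proof. exact: lin_extU. Qed.

Lemma Emap_Fmap m l : m \in G -> l \in G ->
  forall x, Emap qp m l (Fmap qp m l x) = trunc (m + l) x.
Proof.
move=> mG lG; have EwU := Emap_hw_string mG lG.
have := FmapU l mG; move: (Fmap qp m l) => F F_U.
move: EwU; move: (Emap qp m l) => E E_U.
have := truncU (m + l); move: (trunc _) => T T_U.
apply: linear_eq_on_basis => [a u v|a u v|k]; rewrite ?linearP //.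
by rewrite F_U (malg_linearZ E) E_U T_U scalerA mulrC.
Qed.

Lemma Fmap_trunc m l : m \in G -> l \in G ->
  forall x, Fmap qp m l (trunc (m + l) x) = Fmap qp m l x.
Proof.
move=> mG lG; have := FmapU l mG; move: (Fmap qp m l) => F F_U.
have := truncU (m + l); move: (trunc _) => T T_U.
apply: linear_eq_on_basis => [a u v|a u v|k]; rewrite ?linearP //.
rewrite T_U (malg_linearZ F) F_U scalerA; congr (_ *: _).
by have [->|T0] := eqVneq (qfall (m + l) k) 0; rewrite ?invr0 ?mulr0 // divff ?mul1r.
Qed.

(** The coefficient of v_j (x) v_(k - j) in the image of v_k has the factor T_j(m). *)
Lemma trunc_Fmap m l : m \in G -> l \in G -> forall x,
  tens_map (trunc m) (idfun : {malg K[nat]} -> _) (Fmap qp m l x) = Fmap qp m l x.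
Proof.
move=> mG lG; have := FmapU l mG; move: (Fmap qp m l) => F F_U.
have : forall x y, tens_map (trunc m) (idfun : {malg K[nat]} -> _) (tens_vec x y) =
    tens_vec (trunc m x) y by exact: tens_mapE.
move: (tens_map _ _) => T T_E.
apply: linear_eq_on_basis => [a u v|a u v|k]; rewrite ?linearP //.
rewrite F_U (malg_linearZ T); congr (_ *: _).
rewrite /hw_string linear_sum; apply: eq_bigr => -[j jk] _ /=.
rewrite (malg_linearZ T) T_E truncU tens_vecZl scalerA; congr (_ *: _).
rewrite /hw_coef -[LHS]mulrA [X in _ * X]mulrAC; congr (_ * (_ * _)).
by have [->|M0] := eqVneq (qfall m j) 0; rewrite ?mul0r // divff ?mulr1.
Qed.

(** The outermost map of the projector is [Fmap m l], tensored with identities. *)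
Lemma trunc_JW_rec m l nu : m \in G -> l \in G -> forall x,
  tmap (trunc m) (l :: nu) (JW_rec qp m l nu x) = JW_rec qp m l nu x.
Proof.
move=> mG lG; have tF := trunc_Fmap mG lG.
case: nu => [|n nu] x; first exact: tF.
exact: (tmap_comp (nu := n :: nu) tF).
Qed.

Lemma JW_rec_cons m l n nu x : JW_rec qp m l (n :: nu) x =
  tmap (Fmap qp m l) (n :: nu)
    (JW_rec qp (m + l) n nu (tmap (Emap qp m l) (n :: nu) x)).
Proof. by []. Qed.

(** P^2 = f P' (e f) P' e, where e f = [trunc (m + l)] is absorbed by P', whose first
    weight is m + l. *)
Lemma JW_rec_idem m l nu : m \in G -> l \in G -> {subset nu <= G} ->
  forall x, JW_rec qp m l nu (JW_rec qp m l nu x) = JW_rec qp m l nu x.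
Proof.
elim: nu m l => [|n nu IHnu] m l mG lG nuG x.
  rewrite [LHS]/= (_ : Emap qp m l _ = trunc (m + l) (Emap qp m l x)); last first.
    exact: Emap_Fmap.
  exact: Fmap_trunc.
have nG : n \in G by rewrite nuG ?mem_head.
have nuG' : {subset nu <= G} by move=> y ynu; rewrite nuG // inE ynu orbT.
have mlG := rpredD mG lG.
have EF := tmap_comp (nu := n :: nu) (Emap_Fmap mG lG).
rewrite !JW_rec_cons.
by rewrite EF trunc_JW_rec // IHnu.
Qed.

Lemma Uq_tens_vermas_module (I : choiceType) (V : Uq_action K I) nu :
  {subset nu <= G} -> Uq_module qp V -> Uq_module qp (Uq_tens_vermas qp V nu).
Proof.
elim: nu I V => [//|n nu IHnu] I V nuG V_mod /=; apply: IHnu.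
  by move=> y ynu; rewrite nuG // inE ynu orbT.
apply: Uq_tens_module => //; first exact: q_neq0.
by apply: verma_module; rewrite nuG ?mem_head.
Qed.

Lemma JW_rec_linear m l nu : m \in G -> l \in G -> {subset nu <= G} ->
  (forall r k : nat, (r <= size nu)%N ->
     m + l + \sum_(z <- take r nu) z <> k%:R) ->
  let V := Uq_tens_vermas qp (Uq_tens (verma qp m) (verma qp l)) nu in
  Uq_linear V V (JW_rec qp m l nu).
Proof.
elim: nu m l => [|n nu IHnu] m l mG lG nuG sumN /=.
  apply: Uq_linear_comp (Emap_linear mG lG).
  apply: Fmap_linear => // k; have := sumN 0%N k (leq0n _).
  by rewrite big_nil addr0.
have nG : n \in G by rewrite nuG ?mem_head.
have nuG' : {subset nu <= G} by move=> y ynu; rewrite nuG // inE ynu orbT.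
have mlG := rpredD mG lG.
apply: Uq_linear_comp.
  apply: (Uq_linear_tmap qp (n :: nu)).
  apply: Fmap_linear => // k; have := sumN 0%N k (leq0n _).
  by rewrite take0 big_nil addr0.
apply: Uq_linear_comp; last exact: (Uq_linear_tmap qp (n :: nu) (Emap_linear mG lG)).
apply: IHnu => // r k r_le; have := sumN r.+1 k r_le.
by rewrite /= big_cons addrA.
Qed.

Lemma verma_tensor_module mu : (0 < size mu)%N -> {subset mu <= G} ->
  Uq_module qp (verma_tensor qp mu).
Proof.
case: mu => [//|m nu] _ muG; apply: Uq_tens_vermas_module.
  by move=> z znu; rewrite muG // inE znu orbT.
by apply: verma_module; rewrite muG ?mem_head.
Qed.

Lemma JW_linear mu : {subset mu <= G} ->
  (forall r k : nat, (1 < r <= size mu)%N -> \sum_(z <- take r mu) z <> k%:R) ->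
  Uq_linear (verma_tensor qp mu) (verma_tensor qp mu) (JW qp mu).
Proof.
case: mu => [|m [|l nu]] // muG sumN.
apply: JW_rec_linear.
- by rewrite muG ?mem_head.
- by rewrite muG // !inE eqxx orbT.
- by move=> z znu; rewrite muG // !inE znu !orbT.
by move=> r k r_le; have := sumN r.+2 k r_le; rewrite /= !big_cons addrA.
Qed.

Lemma JW_idem mu : {subset mu <= G} ->
  forall x, JW qp mu (JW qp mu x) = JW qp mu x.
Proof.
case: mu => [|m [|l nu]] // muG; apply: JW_rec_idem.
- by rewrite muG ?mem_head.
- by rewrite muG // !inE eqxx orbT.
- by move=> z znu; rewrite muG // !inE znu !orbT.
Qed.

End FormalPowers.

(** * Powers of q in the ground field *)

Section GroundFieldPowers.
Variables (R : realType) (L : fieldType) (Q : formal_powers R L) (mu : seq R[i]).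

Definition ground_exponents : {pred R[i]} :=
  fun z => qpow Q z \in in_ground Q mu.

Lemma ground_exponents_zmod_closed : zmod_closed ground_exponents.
Proof.
split=> [|a b]; last exact: in_ground_powB.
by rewrite -[0](subrr 1) unfold_in; apply: in_ground_powB; apply: in_ground_pow1.
Qed.

HB.instance Definition _ :=
  GRing.isZmodClosed.Build R[i] ground_exponents ground_exponents_zmod_closed.

Lemma ground_exponents1 : 1 \in ground_exponents.
Proof. exact: in_ground_pow1. Qed.

Lemma sub_ground_exponents : {subset mu <= ground_exponents}.
Proof. by move=> z; exact: in_ground_pow. Qed.

Lemma gpow0 : gpow Q mu 0 = 1.
Proof.
have G0 : 0 \in ground_exponents by exact: rpred0.
by apply: val_inj; rewrite rmorph1 /= (gpowE G0) qpow0.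
Qed.

Lemma gpowD :
  {in ground_exponents &, {morph gpow Q mu : a b / a + b >-> a * b}}.
Proof.
move=> a b aG bG; have abG : a + b \in ground_exponents by exact: rpredD.
by apply: val_inj; rewrite rmorphM /= (gpowE abG) (gpowE aG) (gpowE bG) qpowD.
Qed.

Lemma gpow_eq1 : {in ground_exponents, forall z, gpow Q mu z = 1 -> z = 0}.
Proof.
move=> z zG /(congr1 val); rewrite rmorph1 /= gpowE //; exact: qpow_eq1.
Qed.

End GroundFieldPowers.

Lemma sum_tnth_lt (V : nmodType) n (t : n.-tuple V) r : (r <= n)%N ->
  \sum_(i < n | (i < r)%N) tnth t i = \sum_(z <- take r t) z.
Proof.
move=> rn; rewrite (big_nth 0) size_takel ?size_tuple // big_nat.
under eq_bigr => i /andP[_ ir] do rewrite nth_take //.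
rewrite -big_nat (big_nat_widen 0 r n) // big_mkord.
by apply: eq_bigr => i _; rewrite (tnth_nth 0).
Qed.

Theorem theorem4p6 (R : realType) (L : fieldType) (Q : formal_powers R L)
    (n : nat) (mu : n.-tuple R[i])
    (hn : (2 <= n)%N)
    (hmu : forall (i : 'I_n) (k : nat), tnth mu i <> k%:R) :
  let qp : R[i] -> ground_field Q mu := gpow Q mu in
  let V := verma_tensor qp mu in
  let P := JW qp mu in
  [/\ Uq_module qp V,
      (forall r : nat, (1 < r <= n)%N ->
         forall k : nat, \sum_(i < n | (i < r)%N) tnth mu i <> k%:R) ->
        Uq_linear V V P &
      forall x, P (P x) = P x].
Proof.
move=> qp V P.
have G1 := ground_exponents1 Q mu.
have qp0 : qp 0 = 1 := gpow0 Q mu.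
have qpD := @gpowD _ _ Q mu.
have qp_eq1 := @gpow_eq1 _ _ Q mu.
have muG := @sub_ground_exponents _ _ Q mu.
split.
- by apply: (verma_tensor_module G1 qp0 qpD qp_eq1 _ muG); rewrite size_tuple ltnW.
- move=> sumN; apply: (JW_linear G1 qp0 qpD qp_eq1 muG) => r k.
  rewrite size_tuple => /andP[r1 rn]; rewrite -sum_tnth_lt //.
  by apply: sumN; rewrite r1 rn.
- exact: (JW_idem G1 qp0 qpD qp_eq1 muG).
Qed.
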